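(* Let $x,y\in X$ satisfy $1<\partial(x,y)<k$ and write $i=\partial(x,y)$ and $b=q^{2i+1}[k-i][n-k-i]$. The matrix of inner products $\langle u,v\rangle$, with rows indexed by $u=\widehat{x},\widehat{y},B_{xy},C_{xy}$ and columns indexed by $v=\widehat{x},\widehat{y},\widehat{x\cap y},\widehat{x+y}$ (in these orders), has the following rows. Row $\widehat{x}$: $\;q^k[k][n-k],\quad [n][k-i]-[k]^2,\quad q^k[k-i][n-k],\quad q^{k+i}[k][n-k-i]$. Row $\widehat{y}$: $\;[n][k-i]-[k]^2,\quad q^k[k][n-k],\quad q^k[k-i][n-k],\quad q^{k+i}[k][n-k-i]$. Row $B_{xy}$: $\;b\bigl([n][k-1]-[k]^2\bigr),\quad b\bigl([n][k-i-1]-[k]^2\bigr),\quad b\bigl([n][k-i-1]-[k-i][k]\bigr),\quad b\bigl([n][k-1]-[k][k+i]\bigr)$. Row $C_{xy}$: $\;[i]^2\bigl([n][k-1]-[k]^2\bigr),\quad [i]^2\bigl([n][k-i+1]-[k]^2\bigr),\quad q^k[i]^2[k-i][n-k],\quad q^{k+i}[i]^2[k][n-k-i]$.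
   Context: Let $\mathbb{F}_q$ be a finite field with $q$ elements, let $n,k$ be integers with $n>2k\geq 6$, and let $V$ be an $n$-dimensional vector space over $\mathbb{F}_q$. For $m\in\mathbb{Z}$ write $[m]=(q^m-1)/(q-1)$. Let $P$ be the set of all subspaces of $V$ and $P_\ell$ the set of $\ell$-dimensional subspaces; put $X=P_k$. The Grassmann graph $\Gamma=J_q(n,k)$ has vertex set $X$, with $x,y\in X$ adjacent iff $\dim(x\cap y)=k-1$; $\partial$ is its path-length distance and $\Gamma(x)$ is the set of neighbours of $x$. Let $E$ be a (real) Euclidean space of dimension $[n]-1$ with inner product $\langle\,,\,\rangle$, and let $P_1\to E$, $s\mapsto\widehat{s}$ be a map such that: $E=\mathrm{Span}\{\widehat{s}\mid s\in P_1\}$; $\|\widehat{s}\|^2=[n]-1$ for $s\in P_1$; $\langle\widehat{s},\widehat{t}\rangle=-1$ for distinct $s,t\in P_1$; and $\sum_{s\in P_1}\widehat{s}=0$. For $u\in P$ define $\widehat{u}=\sum_{s\in P_1,\,s\subseteq u}\widehat{s}$. For $x,y\in X$ with $1<\partial(x,y)<k$ define $\mathcal{B}_{xy}=\{z\in\Gamma(x)\mid\partial(y,z)=\partial(x,y)+1\}$, $\mathcal{C}_{xy}=\{z\in\Gamma(x)\mid\partial(y,z)=\partial(x,y)-1\}$, and $B_{xy}=\sum_{z\in\mathcal{B}_{xy}}\widehat{z}$, $C_{xy}=\sum_{z\in\mathcal{C}_{xy}}\widehat{z}$. *)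

(* Defs.v *)
From HB Require Import structures.
From mathcomp Require Import all_boot all_order all_algebra.
From mathcomp Require Import sesquilinear reals.

Set Implicit Arguments.
Unset Strict Implicit.
Unset Printing Implicit Defensive.

Import Order.TTheory GRing.Theory Num.Theory.
Local Open Scope ring_scope.

(* Not exported by vector: it holds the matrix subtype structure of {vspace V}. *)
Import VectorInternalTheory.

(* Over a finite field there are finitely many subspaces: they are finite
   as a subtype of the square matrices. *)
HB.instance Definition _ (F : finFieldType) (V : vectType F) :=
  [Countable of {vspace V} by <:].
HB.instance Definition _ (F : finFieldType) (V : vectType F) :=
  [Finite of {vspace V} by <:].

Definition subsp (F : finFieldType) (V : vectType F) (l : nat) : Type :=
  {u : {vspace V} | \dim u == l}.

HB.instance Definition _ (F : finFieldType) (V : vectType F) (l : nat) :=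
  SubFinite.on (subsp V l).

(* Path-length distance of the graph with edge relation e. Two vertices joined
   by a walk are joined by one of length < #|T|; when there is none, find
   returns the default value #|T|. *)
Definition gdist (T : finType) (e : rel T) (x y : T) : nat :=
  find (fun m => [exists p : m.-tuple T, path e x p && (last x p == y)])
       (iota 0 #|T|).

Section Grassmann.
Variables (F : finFieldType) (V : vectType F) (k : nat).
Implicit Types x y z : subsp V k.

Definition grassmann : rel (subsp V k) :=
  fun x y => \dim (val x :&: val y)%VS == k.-1.

Definition gr_dist x y : nat := gdist grassmann x y.

Definition nbrB x y : {set subsp V k} :=
  [set z | grassmann x z & gr_dist y z == (gr_dist x y).+1].

(* gr_dist y z = gr_dist x y - 1, without truncated subtraction *)
Definition nbrC x y : {set subsp V k} :=
  [set z | grassmann x z & (gr_dist y z).+1 == gr_dist x y].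

End Grassmann.

Section Representation.
Variables (F : finFieldType) (V : vectType F) (R : realType) (E : vectType R).
Variable hat : subsp V 1 -> E.

Definition hatu (u : {vspace V}) : E :=
  \sum_(s : subsp V 1 | (val s <= u)%VS) hat s.

Definition vecB (k : nat) (x y : subsp V k) : E :=
  \sum_(z in nbrB x y) hatu (val z).

Definition vecC (k : nat) (x y : subsp V k) : E :=
  \sum_(z in nbrC x y) hatu (val z).

End Representation.

Definition qnum (R : realType) (q : nat) (m : int) : R :=
  (q%:R ^ m - 1) / (q%:R - 1).

(* Main.v *)
Require Import Defs.
From HB Require Import structures.
From mathcomp Require Import all_boot all_order all_algebra.
From mathcomp Require Import finfield sesquilinear reals.
From mathcomp Require Import zify ring.

Set Implicit Arguments.
Unset Strict Implicit.
Unset Printing Implicit Defensive.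

Import Order.TTheory GRing.Theory Num.Theory.
Local Open Scope ring_scope.

(** Because the hat vectors of two points have inner product [n] - 1 or -1
    according as the points agree or not, bilinearity gives, for all subspaces
    u and w,
      <u^, w^> = [n] [dim (u :&: w)] - [dim u] [dim w],
    since a d-dimensional space contains [d] points ([ip_hatu]).  So an inner
    product with B_xy or C_xy is the size of the neighbour set times one such
    value, as soon as dim (z :&: w) is the same for all z in that set.

    Both facts come from translating the graph distance into dimensions:
    dist(x, y) = k - dim (x :&: y) ([gr_distE]).  A step along an edge lowers
    dim (x :&: y) by at most one, and a neighbour of x closer to y exists
    whenever x != y, because the number of such neighbours is positive.

    Write W = x :&: y and i = k - dim W.  A neighbour z closer to y satisfies
    W <= z <= x + y.  It is determined by the hyperplane H = x :&: z of x,
    which contains W ([i] choices), and by a point of the quotient (H + y) / H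
    ([i] choices).  A neighbour z farther from y meets x + y exactly in
    H = x :&: z, a hyperplane of x that does not contain W
    ([k] - [i] = q^i [k-i] choices), and z / H is a point of V / H outside
    (x + y) / H ([n-k+1] - [i+1] = q^(i+1) [n-k-i] choices).  These
    descriptions give the sizes ([card_closer], [card_farther]) and the
    dimensions of the intersections of z with x, y, W and x + y.  What is left
    is the identity [a + b] = [a] + q^a [b]. *)

(** * Gaussian integers *)

(** The number [d] as a natural number, so that cardinals can be compared with
    it without division. *)
Definition qint (q d : nat) : nat := (\sum_(i < d) q ^ i)%N.

Lemma qint0 q : qint q 0 = 0%N.
Proof. by rewrite /qint big_ord0. Qed.

Lemma qint1 q : qint q 1 = 1%N.
Proof. by rewrite /qint big_ord1. Qed.

Lemma qintS q d : qint q d.+1 = (qint q d + q ^ d)%N.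
Proof. by rewrite /qint big_ord_recr. Qed.

Lemma qint_gt0 q d : (0 < d)%N -> (0 < qint q d)%N.
Proof. by case: d => // d _; rewrite /qint big_ord_recl. Qed.

Lemma qintD q d e : qint q (d + e) = (qint q d + q ^ d * qint q e)%N.
Proof.
elim: e => [|e IHe]; first by rewrite qint0 muln0 !addn0.
by rewrite addnS !qintS IHe mulnDr expnD addnA.
Qed.

Lemma expnDB q w d : (q ^ (w + d) - q ^ w = q ^ w * q.-1 * qint q d)%N.
Proof. by rewrite -mulnA -predn_exp expnD -subn1 mulnBr muln1. Qed.

Lemma qnumE (R : realType) q d : (1 < q)%N -> qnum R q d%:Z = (qint q d)%:R.
Proof.
move=> q1; have q10 : (q%:R - 1 : R) != 0.
  by rewrite -[1]/(1%:R) -natrB ?(ltnW q1) // pnatr_eq0 -lt0n subn_gt0.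
apply: (mulIf q10); rewrite /qnum divfK // -exprnP mulrC.
rewrite -[1]/(1%:R) -natrX -!natrB ?expn_gt0 ?(ltnW q1) //.
by rewrite -natrM subn1 predn_exp subn1.
Qed.

(** * Counting subspaces in an interval *)

Section Counting.
Variables (F : finFieldType) (V : vectType F).
Implicit Types (U W H x y z : {vspace V}) (u v : finvect_type V).
Local Notation q := #|F|.

Let q_gt1 : (1 < q)%N := finNzRing_gt1 F.

Lemma card_mem_vspace U : #|[set v : finvect_type V | v \in U]| = (q ^ \dim U)%N.
Proof.
(* Destructing V makes its vector structure and the one carried by
   finvect_type V convertible. *)
rewrite cardsE; case: V U => T c U.
exact: (@card_vspace F (finvect_type (Vector.Pack c)) c U).
Qed.

Lemma card_vspaceD U W :
  (W <= U)%VS ->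
  #|[set v : finvect_type V | (v \in U) && (v \notin W)]|
    = (q ^ \dim W * q.-1 * qint q (\dim U - \dim W))%N.
Proof.
move=> WU; rewrite -expnDB subnKC ?dimvS //.
rewrite -!card_mem_vspace.
rewrite -cardsDS; last by apply/subsetP=> v; rewrite !inE; apply/subvP.
by apply: eq_card => v; rewrite !inE andbC.
Qed.

Lemma dim_add_line W (v : V) : v \notin W -> \dim (W + <[v]>)%VS = (\dim W).+1.
Proof.
move=> vW; have v0 : v != 0 by apply: contraNneq vW => ->; rewrite mem0v.
rewrite dimv_disjoint_sum ?dim_vline ?v0 ?addn1 //.
apply/eqP; rewrite -subv0; apply/subvP=> t; rewrite memv_cap => /andP[tW].
case/vlineP=> c tE; rewrite memv0 tE; move: tW; rewrite tE.
have [->|c0] := eqVneq c 0; first by rewrite scale0r.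
by rewrite rpredZeq (negPf c0) (negPf vW).
Qed.

Definition covers W U : {set {vspace V}} :=
  [set H : {vspace V} | [&& (W <= H)%VS, (H <= U)%VS & \dim H == (\dim W).+1]].

Definition cocovers W U : {set {vspace V}} :=
  [set H : {vspace V} | [&& (W <= H)%VS, (H <= U)%VS & (\dim H).+1 == \dim U]].

(** Each vector v of U outside W spans with W a cover W + <[v]>, and a cover H
    arises from exactly the q^(dim W) (q - 1) vectors of H outside W. *)
Lemma card_covers W U :
  (W <= U)%VS -> #|covers W U| = qint q (\dim U - \dim W).
Proof.
move=> WU.
have c0 : (0 < q ^ \dim W * q.-1)%N.
  by rewrite muln_gt0 expn_gt0 (ltnW q_gt1) -subn1 subn_gt0.
apply/eqP; rewrite -(eqn_pmul2r c0) [X in _ == X]mulnC -card_vspaceD //.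
rewrite -[X in _ == X]sum1_card; apply/eqP.
rewrite (partition_big (fun v => W + <[v : V]>)%VS (mem (covers W U))) /=.
  rewrite -sum_nat_const; apply: eq_bigr => H.
  rewrite inE => /and3P[WH HU /eqP dH].
  rewrite sum1_card -[(_ * _)%N]muln1 -[X in (_ * X)%N](qint1 q).
  have -> : 1%N = (\dim H - \dim W)%N by rewrite dH subSnn.
  rewrite -card_vspaceD //; apply: eq_card => v; rewrite !inE [RHS]unfold_in /= inE.
  apply/andP/andP => [[vH vW]|[/andP[vU vW] /eqP <-]].
    split; last first.
      rewrite -(geq_leqif (dimv_leqif_eq _)) ?dim_add_line ?dH //.
      by rewrite subv_add WH -memvE.
    by rewrite vW andbT; apply: (subvP HU).
  by split=> //; apply: (subvP (addvSr W <[v : V]>)); apply: memv_line.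
move=> v; rewrite !inE => /andP[vU vW].
by rewrite addvSl subv_add WU -memvE vU dim_add_line //=.
Qed.

(** Instead of dualising, this counts the pairs (H, v) where H is a hyperplane
    of U containing W and v is in H but not in W.  For fixed v the admissible H
    are those containing W + <[v]>, which induction on the codimension counts;
    for fixed H the admissible v are counted directly. *)
Lemma card_cocovers W U :
  (W <= U)%VS -> #|cocovers W U| = qint q (\dim U - \dim W).
Proof.
move Ed: (\dim U - \dim W)%N => d; elim: d => [|d IHd] in W Ed *.
  move=> WU; rewrite qint0; apply: eq_card0 => H; rewrite !inE.
  apply/and3P=> -[WH HU /eqP dH]; have := dimvS WH; have := dimvS WU; lia.
move=> WU; have leWU := dimvS WU.
(* In codimension 1 there are no pairs (H, v) to count: W is the only H. *)
have [d0|d_gt0] := posnP d.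
  rewrite d0 qint1 (_ : cocovers W U = [set W]) ?cards1 //.
  apply/setP=> H; rewrite !inE; apply/and3P/eqP => [[WH HU /eqP dH]|->].
    by apply/eqP; rewrite eq_sym -(geq_leqif (dimv_leqif_eq WH)); lia.
  by split=> //; apply/eqP; lia.
have c0 : (0 < q ^ \dim W * q.-1)%N.
  by rewrite muln_gt0 expn_gt0 (ltnW q_gt1) -subn1 subn_gt0.
apply/eqP; rewrite -(eqn_pmul2r (qint_gt0 q d_gt0)) -(eqn_pmul2r c0); apply/eqP.
transitivity (\sum_(H in cocovers W U)
    \sum_(v : finvect_type V | (v \in H) && (v \notin W)) 1)%N.
  rewrite -mulnA -sum_nat_const; apply: eq_bigr => H.
  rewrite inE => /and3P[WH HU /eqP dH].
  rewrite sum1dep_card card_vspaceD // mulnC; congr (_ * qint q _)%N; lia.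
rewrite (exchange_big_dep (fun v : finvect_type V => (v \in U) && (v \notin W))) /=.
  transitivity (\sum_(v : finvect_type V | (v \in U) && (v \notin W)) qint q d)%N.
    apply: eq_bigr => v /andP[vU vW]; rewrite sum1dep_card.
    have dWv := dim_add_line vW.
    rewrite -(IHd (W + <[v : V]>)%VS); last first.
    - by rewrite subv_add WU -memvE.
    - by rewrite dWv; lia.
    apply: eq_card => H; rewrite !inE subv_add -memvE vW andbT.
    by rewrite -!andbA; do !bool_congr.
  by rewrite sum_nat_cond_const card_vspaceD // Ed -[LHS]mulnA mulnC.
move=> H v; rewrite inE => /and3P[WH HU _] /andP[vH ->]; rewrite andbT.
exact: (subvP HU).
Qed.


Lemma card_fibre (T1 T2 : finType) (f : T1 -> T2) (A : {set T1}) (B : {set T2}) m :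
  (forall a, a \in A -> f a \in B) ->
  (forall c, c \in B -> #|[set a in A | f a == c]| = m) ->
  #|A| = (#|B| * m)%N.
Proof.
move=> fAB fm; rewrite -sum1_card (partition_big f (mem B)) //=.
rewrite -sum_nat_const; apply: eq_bigr => c cB.
by rewrite sum1dep_card fm.
Qed.

Lemma subv_dim_eq U W : (U <= W)%VS -> (\dim W <= \dim U)%N -> U = W.
Proof. by move=> UW dWU; apply/eqP; rewrite eqEdim UW. Qed.

(** * Neighbours of x closer to y and farther from y *)

Section TwoVertices.
Variables x y : {vspace V}.
Let k := \dim x.
Let d := \dim (x :&: y)%VS.

(** With x and y of dimension k, these are the dimension conditions that
    characterise the two neighbour sets of the Grassmann graph, once distance
    has been expressed through dim (x :&: y). *)
Definition closer : {set {vspace V}} :=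
  [set z : {vspace V} | [&& \dim z == k, (\dim (x :&: z)%VS).+1 == k
                          & \dim (y :&: z)%VS == d.+1]].

Definition farther : {set {vspace V}} :=
  [set z : {vspace V} | [&& \dim z == k, (\dim (x :&: z)%VS).+1 == k
                          & (\dim (y :&: z)%VS).+1 == d]].

(** The subspaces x :&: z and y :&: z of z meet inside x :&: y, and their
    dimensions k - 1 and d + 1 force this meet to be all of x :&: y and their
    sum to be all of z. *)
Lemma closer_between z : z \in closer -> (x :&: y <= z)%VS /\ (z <= x + y)%VS.
Proof.
rewrite inE => /and3P[/eqP dz /eqP dxz /eqP dyz].
have sz : (x :&: z + y :&: z <= z)%VS by rewrite subv_add !capvSr.
have sxy : (x :&: z :&: (y :&: z) <= x :&: y)%VS.
  by rewrite capvS ?capvSl.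
have := dimv_sum_cap (x :&: z) (y :&: z).
move: (dimvS sz) (dimvS sxy); rewrite -/d => d1 d2 d3; split.
  rewrite -(subv_dim_eq sxy); last by rewrite -/d; lia.
  by rewrite (subv_trans (capvSl _ _)) ?capvSr.
rewrite -(subv_dim_eq sz); last by lia.
by rewrite addvS ?capvSl.
Qed.

Hypothesis dim_y : \dim y = k.

(** Were z inside x + y, so would be y + z, whose dimension exceeds that of
    x + y by one; so z meets x + y in a hyperplane of z, as it meets x. *)
Lemma farther_cap_sum z : z \in farther -> (z :&: (x + y))%VS = (x :&: z)%VS.
Proof.
rewrite inE => /and3P[/eqP dz /eqP dxz /eqP dyz].
apply/esym/subv_dim_eq.
  by rewrite subv_cap capvSr (subv_trans (capvSl _ _)) ?addvSl.
rewrite -ltnS dxz -dz ltn_neqAle dimvS ?capvSl // andbT.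
apply/negP=> /eqP dE; have /eqP/capv_idPl zE : (z :&: (x + y) == z)%VS.
  by rewrite eqEdim capvSl dE /=.
have := dimvS (_ : y + z <= x + y)%VS; rewrite subv_add addvSr zE => /(_ isT).
have := dimv_sum_cap x y; have := dimv_sum_cap y z; rewrite -/d -/k; lia.
Qed.

Lemma farther_cap z : z \in farther -> (y :&: z <= x)%VS.
Proof.
move=> zB; apply: (subv_trans _ (capvSl x z)).
by rewrite -(farther_cap_sum zB) capvC capvS ?addvSr.
Qed.

Lemma cocover_cap H : H \in cocovers (x :&: y) x -> (H :&: y)%VS = (x :&: y)%VS.
Proof.
rewrite inE => /and3P[WH Hx _]; apply/eqP; rewrite eqEsubv capvS //=.
by rewrite subv_cap WH capvSr.
Qed.

(** Fibering over H = x :&: z: the base is the set of hyperplanes of x above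
    x :&: y, and the fibre over H is the set of all covers of H below H + y. *)
Lemma card_closer : #|closer| = (qint q (k - d) ^ 2)%N.
Proof.
rewrite -mulnn -{1}(card_cocovers (capvSl x y)).
apply: (card_fibre (f := fun z => x :&: z)%VS).
  move=> z zC; have [Wz _] := closer_between zC.
  by move: zC; rewrite !inE capvSl subv_cap capvSl Wz => /and3P[_ -> _].
move=> H HW; have HyE := cocover_cap HW.
move: HW; rewrite inE => /and3P[WH Hx /eqP dH].
have dHy := dimv_sum_cap H y; rewrite HyE dim_y -/d -/k in dHy dH.
have -> : (k - d = \dim (H + y)%VS - \dim H)%N by have := dimvS WH; lia.
rewrite -card_covers ?addvSl //; apply: eq_card => z; rewrite !inE.
apply/andP/and3P => [[/and3P[/eqP dz /eqP dxz /eqP dyz] /eqP xzE]|].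
  have Hz : (H <= z)%VS by rewrite -xzE capvSr.
  split=> //; last by apply/eqP; lia.
  have sz : (H + y :&: z <= z)%VS by rewrite subv_add Hz capvSr.
  rewrite -(subv_dim_eq sz) ?addvS ?capvSl //.
  have /dimvS : (H :&: (y :&: z) <= x :&: y)%VS by rewrite capvS ?capvSl.
  by have := dimv_sum_cap H (y :&: z); rewrite -/d; lia.
case=> Hz zHy /eqP dz.
have xzE : (x :&: z)%VS = H.
  apply/esym/subv_dim_eq; first by rewrite subv_cap Hx.
  rewrite -ltnS -dz ltn_neqAle dimvS ?capvSr // andbT.
  apply/negP=> /eqP dE; have zx : (z <= x)%VS.
    by rewrite -(subv_dim_eq (capvSr x z)) ?capvSl ?dE.
  have zE : z = x by apply: subv_dim_eq => //; rewrite dz dH.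
  have := dimvS (_ : x + y <= H + y)%VS; rewrite subv_add addvSr -{1}zE zHy.
  by move=> /(_ isT); have := dimv_sum_cap x y; rewrite -/d -/k dim_y; lia.
rewrite xzE dz dH !eqxx /=; split=> //.
have zE : (z :&: (H + y))%VS = z by apply/capv_idPl.
(* By the modular law z = H + (z :&: y), which gives dim (z :&: y). *)
have := vspace_modr y Hz; rewrite [(y + H)%VS]addvC zE => zE'.
have := dimv_sum_cap (z :&: y) H; rewrite zE' dz.
have -> : (z :&: y :&: H)%VS = (x :&: y)%VS.
  by rewrite -HyE capvC capvA (capv_idPl Hz).
by rewrite [(z :&: y)%VS]capvC -/d => dd; apply/eqP; lia.
Qed.

(** Fibering over H = x :&: z: the base is the set of hyperplanes of x not
    above x :&: y, and the fibre over H is the set of all covers of H not below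
    x + y. *)
Lemma card_farther :
  #|farther| = (q ^ (\dim (x + y)%VS - k).+1 * qint q (\dim {:V} - \dim (x + y)%VS)
                * (q ^ (k - d) * qint q d))%N.
Proof.
have cW : #|cocovers 0 x :\: cocovers (x :&: y) x| = (q ^ (k - d) * qint q d)%N.
  rewrite cardsDS; last first.
    by apply/subsetP=> H; rewrite !inE => /and3P[_ -> ->]; rewrite sub0v.
  rewrite !card_cocovers ?sub0v ?capvSl // dimv0 subn0 -/k -/d.
  have dk : (d <= k)%N by apply/dimvS/capvSl.
  by rewrite -{1}(subnK dk) qintD addKn.
rewrite mulnC -cW; apply: (card_fibre (f := fun z => x :&: z)%VS).
  move=> z zB; have yzx := farther_cap zB; move: zB; rewrite !inE sub0v capvSl.
  case/and3P=> [_ -> /eqP dyz]; rewrite !andbT; apply/negP => Wz.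
  suff /dimvS : (x :&: y <= y :&: z)%VS by rewrite -/d; lia.
  by rewrite subv_cap capvSr (subv_trans Wz) ?capvSr.
move=> H; rewrite !inE sub0v /= => /andP[WH /andP[Hx /eqP dH]].
rewrite Hx dH eqxx !andbT in WH; rewrite -/k in dH.
have Hxy : (H <= x + y)%VS by rewrite (subv_trans Hx) ?addvSl.
have xyk : (k <= \dim (x + y)%VS)%N by apply/dimvS/addvSl.
have -> : (q ^ (\dim (x + y)%VS - k).+1 * qint q (\dim {:V} - \dim (x + y)%VS))%N
          = #|covers H fullv :\: covers H (x + y)|.
  rewrite cardsDS; last first.
    by apply/subsetP=> z; rewrite !inE => /and3P[-> _ ->]; rewrite subvf.
  have xyn : (\dim (x + y)%VS <= \dim {:V})%N by apply/dimvS/subvf.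
  rewrite !card_covers ?subvf //.
  have -> : (\dim {:V} - \dim H
     = (\dim (x + y)%VS - k).+1 + (\dim {:V} - \dim (x + y)%VS))%N by lia.
  have -> : (\dim (x + y)%VS - \dim H = (\dim (x + y)%VS - k).+1)%N by lia.
  by rewrite qintD addKn.
apply: eq_card => z; rewrite !inE subvf /=.
apply/andP/andP=> [[/and3P[/eqP dz /eqP dxz /eqP dyz] /eqP xzE]|].
  have Hz : (H <= z)%VS by rewrite -xzE capvSr.
  rewrite Hz /= dz dH eqxx andbT; split=> //; apply/negP=> zxy.
  have := dimvS (_ : y + z <= x + y)%VS; rewrite subv_add addvSr zxy => /(_ isT).
  have := dimv_sum_cap x y; have := dimv_sum_cap y z; rewrite -/d -/k; lia.
case=> zxy /andP[Hz /eqP dz]; rewrite dz dH eqxx andbT Hz /= in zxy.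
have zxyE : (z :&: (x + y))%VS = H.
  apply/esym/subv_dim_eq; first by rewrite subv_cap Hz.
  rewrite -ltnS -dz ltn_neqAle dimvS ?capvSl // andbT.
  apply/negP=> /eqP dE; case/negP: zxy; apply/capv_idPl/subv_dim_eq.
    exact: capvSl.
  by rewrite dE.
have xzE : (x :&: z)%VS = H.
  by apply/eqP; rewrite eqEsubv subv_cap Hx Hz andbT -zxyE capvC capvS ?addvSl.
have yzE : (y :&: z)%VS = (H :&: (x :&: y))%VS.
  have yzH : (y :&: z <= H)%VS by rewrite -zxyE capvC capvS ?addvSr.
  apply/eqP; rewrite eqEsubv !subv_cap yzH (subv_trans yzH Hx) capvSl /=.
  by rewrite (subv_trans (capvSl _ _) Hz) (subv_trans (capvSr _ _)) ?capvSr.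
have HWx : (H + x :&: y)%VS = x.
  apply: subv_dim_eq; first by rewrite subv_add Hx capvSl.
  rewrite -/k -dH ltn_neqAle dimvS ?addvSl // andbT; apply/negP=> /eqP dE.
  case/negP: WH; rewrite (subv_dim_eq (addvSl H (x :&: y)%VS)) ?addvSr //.
  by rewrite -dE.
rewrite xzE dz dH yzE !eqxx /=; split=> //.
have := dimv_sum_cap H (x :&: y); rewrite HWx -/d -/k.
by move=> dd; apply/eqP; lia.
Qed.

End TwoVertices.
End Counting.

(** * Distance in the Grassmann graph *)

(** The search in [gdist] stops before its bound #|T|: a shortest walk repeats
    no vertex. *)
Lemma gdist_shortest (T : finType) (e : rel T) (a c : T) (p : seq T) :
  path e a p -> last a p = c ->
  (forall p', path e a p' -> last a p' = c -> (size p <= size p')%N) ->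
  gdist e a c = size p.
Proof.
move=> ep pc pmin; rewrite /gdist; set P := (P in find P _).
have sp : (size p < #|T|)%N.
  case/shortenP: ep pc => p' ep' up' _ /(pmin _ ep') /leq_ltn_trans; apply.
  by rewrite -[(size p').+1]/(size (a :: p')) -(card_uniqP up') max_card.
have Pp : P (size p).
  by apply/existsP; exists (in_tuple p); rewrite ep pc eqxx.
have hasP : has P (iota 0 #|T|).
  by apply/hasP; exists (size p); rewrite // mem_iota.
have ltf : (find P (iota 0 #|T|) < #|T|)%N by move: hasP; rewrite has_find size_iota.
apply/eqP; rewrite eqn_leq; apply/andP; split.
  rewrite leqNgt; apply/negP=> lt.
  by have := before_find 0%N lt; rewrite nth_iota // add0n Pp.
have := nth_find 0%N hasP; rewrite nth_iota // add0n.
case/existsP=> p' /andP[ep' /eqP pc'].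
by have := pmin _ ep' pc'; rewrite size_tuple.
Qed.

Section Distance.
Variables (F : finFieldType) (V : vectType F) (k : nat).
Implicit Types x y z : subsp V k.

Lemma dim_subsp x : \dim (val x) = k.
Proof. exact/eqP/(valP x). Qed.

Lemma card_subsp (A : {set subsp V k}) (B : {set {vspace V}}) :
  (forall x, (x \in A) = (val x \in B)) ->
  {in B, forall u, \dim u = k} -> #|A| = #|B|.
Proof.
move=> AB dB; rewrite -(card_imset _ val_inj); apply: eq_card => u.
apply/imsetP/idP=> [[x xA ->]|uB]; first by rewrite -AB.
have du : \dim u == k by apply/eqP/dB.
by exists (Sub u du); rewrite ?AB SubK.
Qed.

(** If w is adjacent to x then (x :&: w) and (w :&: y) lie in w, so by the
    dimension formula dim (x :&: y) >= dim (w :&: y) - 1. *)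
Lemma path_grassmann_ge x p : path (@grassmann F V k) x p ->
  (k <= \dim (val x :&: val (last x p))%VS + size p)%N.
Proof.
elim: p x => [|w p IHp] x; first by rewrite [last x _]/= capvv dim_subsp addn0.
rewrite [path _ _ _]/= [last _ _]/= [size _]/=.
case/andP=> /eqP dxw /IHp; move: (last w p) => y le_k.
have s1 : (val x :&: val w + val w :&: val y <= val w)%VS.
  by rewrite subv_add capvSr capvSl.
have s2 : (val x :&: val w :&: (val w :&: val y) <= val x :&: val y)%VS.
  by rewrite capvS ?capvSl ?capvSr.
have := dimv_sum_cap (val x :&: val w) (val w :&: val y).
move: (dimvS s1) (dimvS s2); rewrite dxw dim_subsp; lia.
Qed.

(** A step towards y exists as long as dim (x :&: y) < k, because [card_closer]
    is then positive. *)
Lemma path_grassmann_exists x y : exists p,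
  [/\ path (@grassmann F V k) x p, last x p = y
     & size p = (k - \dim (val x :&: val y)%VS)%N].
Proof.
move Ed: (k - \dim (val x :&: val y)%VS)%N => d.
elim: d => [|d IHd] in x Ed *.
  have kd : (k <= \dim (val x :&: val y)%VS)%N by rewrite -subn_eq0 Ed.
  exists [::]; split=> //=; apply: val_inj.
  transitivity (val x :&: val y)%VS; [apply: esym|]; apply: subv_dim_eq.
  - exact: capvSl.
  - by rewrite dim_subsp.
  - exact: capvSr.
  - by rewrite dim_subsp.
have /card_gt0P[u] : (0 < #|closer (val x) (val y)|)%N.
  by rewrite card_closer ?dim_subsp // Ed expn_gt0 qint_gt0.
rewrite inE !dim_subsp => /and3P[du /eqP dxu /eqP dyu].
have [|p [ep py sp]] := IHd (Sub u du).
  by rewrite SubK capvC; move: dyu Ed; lia.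
exists (Sub u du :: p); split=> //=; last by rewrite sp.
by rewrite ep andbT /grassmann SubK; apply/eqP; lia.
Qed.

Lemma gr_distE x y : gr_dist x y = (k - \dim (val x :&: val y)%VS)%N.
Proof.
have [p [ep py sp]] := path_grassmann_exists x y; rewrite -sp.
apply: gdist_shortest => // p' ep' py'; rewrite sp leq_subLR.
by have := path_grassmann_ge ep'; rewrite py'.
Qed.

Lemma dim_cap_le x y : (\dim (val x :&: val y)%VS <= k)%N.
Proof. by rewrite -[X in (_ <= X)%N](dim_subsp x) dimvS ?capvSl. Qed.

Lemma nbrC_closer x y z :
  (0 < k)%N -> (z \in nbrC x y) = (val z \in closer (val x) (val y)).
Proof.
move=> k0; have d1 := dim_cap_le x y; have d2 := dim_cap_le y z.
by rewrite !inE !gr_distE !dim_subsp eqxx andTb /grassmann; congr (_ && _); lia.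
Qed.

Lemma nbrB_farther x y z :
  (0 < k)%N -> (z \in nbrB x y) = (val z \in farther (val x) (val y)).
Proof.
move=> k0; have d1 := dim_cap_le x y; have d2 := dim_cap_le y z.
by rewrite !inE !gr_distE !dim_subsp eqxx andTb /grassmann; congr (_ && _); lia.
Qed.

End Distance.

(** * Inner products of hat vectors *)

(** Points of u are the covers of the zero subspace inside u. *)
Lemma card_points (F : finFieldType) (V : vectType F) (u : {vspace V}) :
  #|[set s : subsp V 1 | (val s <= u)%VS]| = qint #|F| (\dim u).
Proof.
have <- : (\dim u - \dim (0%VS : {vspace V}) = \dim u)%N by rewrite dimv0 subn0.
rewrite -card_covers ?sub0v //.
apply: card_subsp => [s|w]; rewrite !inE sub0v dimv0 /=.
  by rewrite dim_subsp andbT.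
by case/andP=> _ /eqP.
Qed.

Section InnerProducts.
Variables (F : finFieldType) (V : vectType F) (R : realType) (E : vectType R).
Variables (ip : {dot E for (@idfun R)}) (hat : subsp V 1 -> E) (N : R).
Hypothesis hat_norm : forall s, ip (hat s) (hat s) = N - 1.
Hypothesis hat_ip : forall s t, s != t -> ip (hat s) (hat t) = -1.
Local Notation br d := ((qint #|F| d)%:R : R).

(** Of the pairs of points (s, t) with s in u and t in w, each contributes -1,
    and the pairs with s = t, one for each point of u :&: w, contribute N
    more. *)
Lemma ip_hatu (u w : {vspace V}) :
  ip (hatu hat u) (hatu hat w)
    = N * br (\dim (u :&: w)%VS) - br (\dim u) * br (\dim w).
Proof.
have hatE s t : ip (hat s) (hat t) = N * (s == t)%:R - 1.
  by have [<-|/hat_ip->] := eqVneq s t; rewrite ?hat_norm ?mulr1 ?mulr0 ?sub0r.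
rewrite /hatu linear_sumlz.
transitivity (\sum_(s : subsp V 1 | (val s <= u)%VS)
   (N * ((val s <= w)%VS)%:R - br (\dim w))).
  apply: eq_bigr => s su; rewrite linear_sumr.
  transitivity (\sum_(t : subsp V 1 | (val t <= w)%VS) (N * (s == t)%:R - 1)).
    by apply: eq_bigr => t _; exact: hatE.
  rewrite sumrB -mulr_sumr sumr_const -card_points cardsE; congr (_ * _ - _).
  have [sw|sw] := boolP (val s <= w)%VS.
    rewrite (bigD1 s) //= eqxx big1 ?addr0 // => t /andP[_ /negPf].
    by rewrite eq_sym => ->.
  rewrite big1 // => t tw; case: eqP => // st; by rewrite st tw in sw.
rewrite sumrB -mulr_sumr sumr_const -[X in _ - X]mulr_natl; congr (_ * _ - _ * _).
  rewrite -natr_sum -big_mkcondr /= sum1dep_card -card_points; congr _%:R.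
  by apply: eq_card => s; rewrite !inE subv_cap.
by rewrite -card_points cardsE.
Qed.

Lemma ip_sum_hatu (k m : nat) (A : {set subsp V k}) (w : {vspace V}) :
  (forall z, z \in A -> \dim (val z :&: w)%VS = m) ->
  ip (\sum_(z in A) hatu hat (val z)) (hatu hat w)
    = #|A|%:R * (N * br m - br k * br (\dim w)).
Proof.
move=> Am; rewrite linear_sumlz mulr_natl -sumr_const.
apply: eq_bigr => z zA; apply: etrans (ip_hatu (val z) w) _.
by rewrite Am // dim_subsp.
Qed.

End InnerProducts.

Theorem theorem10p9
  (F : finFieldType) (V : vectType F) (n k : nat)
  (dimV : \dim {:V} = n) (nk : (2 * k < n)%N) (k3 : (6 <= 2 * k)%N)
  (R : realType) (E : vectType R) (ip : {dot E for (@idfun R)})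
  (hat : subsp V 1 -> E)
  (dimE : (\dim {:E})%:R = qnum R #|F| n - 1)
  (hat_span : (<<[seq hat s | s : subsp V 1]>>)%VS = fullv)
  (hat_norm : forall s : subsp V 1, ip (hat s) (hat s) = qnum R #|F| n - 1)
  (hat_ip : forall s t : subsp V 1, s != t -> ip (hat s) (hat t) = -1)
  (hat_sum : \sum_(s : subsp V 1) hat s = 0)
  (x y : subsp V k) (hxy : (1 < gr_dist x y < k)%N) :
  let i := gr_dist x y in
  let q : R := #|F|%:R in
  let br (m : int) : R := qnum R #|F| m in
  let K := k%:Z in let N := n%:Z in let I := i%:Z in
  let b := q ^+ (2 * i + 1) * br (K - I) * br (N - K - I) in
  let us := [:: hatu hat (val x); hatu hat (val y);
                vecB hat x y; vecC hat x y] in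
  let vs := [:: hatu hat (val x); hatu hat (val y);
                hatu hat (val x :&: val y)%VS;
                hatu hat (val x + val y)%VS] in
  let rows : seq (seq R) :=
    [:: [:: q ^+ k * br K * br (N - K);
            br N * br (K - I) - br K ^+ 2;
            q ^+ k * br (K - I) * br (N - K);
            q ^+ (k + i) * br K * br (N - K - I)];
        [:: br N * br (K - I) - br K ^+ 2;
            q ^+ k * br K * br (N - K);
            q ^+ k * br (K - I) * br (N - K);
            q ^+ (k + i) * br K * br (N - K - I)];
        [:: b * (br N * br (K - 1) - br K ^+ 2);
            b * (br N * br (K - I - 1) - br K ^+ 2);
            b * (br N * br (K - I - 1) - br (K - I) * br K);
            b * (br N * br (K - 1) - br K * br (K + I))];
        [:: br I ^+ 2 * (br N * br (K - 1) - br K ^+ 2);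
            br I ^+ 2 * (br N * br (K - I + 1) - br K ^+ 2);
            q ^+ k * br I ^+ 2 * br (K - I) * br (N - K);
            q ^+ (k + i) * br I ^+ 2 * br K * br (N - K - I)]] in
  \matrix_(r < 4, c < 4) ip (nth 0 us r) (nth 0 vs c)
    = \matrix_(r < 4, c < 4) nth 0 (nth [::] rows r) c.
Proof.
move=> i q br K N I b us vs rows.
have q1 : (1 < #|F|)%N := finNzRing_gt1 F.
have k_gt0 : (0 < k)%N by lia.
set W := (val x :&: val y)%VS.
have dim_yx : \dim (val y) = \dim (val x) by rewrite !dim_subsp.
have iE : i = (k - \dim W)%N by exact: gr_distE.
(* Parameters i, j, m are chosen so that dim W = k - i = j + 1 is visibly
   positive, k = i + j + 1 and n = k + i + m: no subtraction remains. *)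
have [j dW] : exists j, \dim W = j.+1 by exists (k - i).-1; lia.
have kE : k = (i + j.+1)%N by lia.
have dS : \dim (val x + val y)%VS = (k + i)%N.
  by have := dimv_sum_cap (val x) (val y); rewrite !dim_subsp -/W; lia.
have [m nE] : exists m, n = (k + i + m)%N.
  by exists (n - k - i)%N; rewrite -dimV; have := dimvS (subvf (val x + val y)); lia.
pose g d : R := (qint #|F| d)%:R.
have brE (d : nat) : br d%:Z = g d by exact: qnumE.
have cardC : #|nbrC x y|%:R = g i ^+ 2.
  rewrite (card_subsp (B := closer (val x) (val y))) => [|z|z].
  - by rewrite card_closer !dim_subsp // -/W -iE natrX.
  - exact: nbrC_closer.
  - by rewrite inE dim_subsp => /and3P[/eqP].
have cardB : #|nbrB x y|%:R = q ^+ i.+1 * g m * (q ^+ i * g j.+1).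
  rewrite (card_subsp (B := farther (val x) (val y))) => [|z|z].
  - rewrite card_farther !dim_subsp // -/W -iE dS dimV dW !natrM !natrX.
    by congr (q ^+ _ * g _ * _); lia.
  - exact: nbrB_farther.
  - by rewrite inE dim_subsp => /and3P[/eqP].
have Wx : (W <= val x)%VS by exact: capvSl.
have Wy : (W <= val y)%VS by exact: capvSr.
have xS : (val x <= val x + val y)%VS by exact: addvSl.
have yS : (val y <= val x + val y)%VS by exact: addvSr.
have ipE u w : ip (hatu hat u) (hatu hat w)
    = br N * g (\dim (u :&: w)%VS) - g (\dim u) * g (\dim w).
  exact: ip_hatu hat_norm hat_ip u w.
have ipC w c : (forall z, z \in closer (val x) (val y) -> \dim (z :&: w)%VS = c) ->
  ip (vecC hat x y) (hatu hat w) = g i ^+ 2 * (br N * g c - g k * g (\dim w)).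
  move=> Cc; rewrite -cardC; apply: (ip_sum_hatu hat_norm hat_ip) => z.
  by rewrite nbrC_closer //; apply: Cc.
have ipB w c : (forall z, z \in farther (val x) (val y) -> \dim (z :&: w)%VS = c) ->
  ip (vecB hat x y) (hatu hat w)
    = q ^+ i.+1 * g m * (q ^+ i * g j.+1) * (br N * g c - g k * g (\dim w)).
  move=> Bc; rewrite -cardB; apply: (ip_sum_hatu hat_norm hat_ip) => z.
  by rewrite nbrB_farther //; apply: Bc.
have brN : br N = g n by exact: brE.
have brK : br K = g k by exact: brE.
have brKI : br (K - I) = g j.+1 by rewrite -brE; congr br; lia.
have brNK : br (N - K) = g (i + m)%N by rewrite -brE; congr br; lia.
have brNKI : br (N - K - I) = g m by rewrite -brE; congr br; lia.
have brK1 : br (K - 1) = g (i + j)%N by rewrite -brE; congr br; lia.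
have brKI1 : br (K - I - 1) = g j by rewrite -brE; congr br; lia.
have brKI2 : br (K - I + 1) = g j.+2 by rewrite -brE; congr br; lia.
have brKpI : br (K + I) = g (k + i)%N by rewrite -brE; congr br; lia.
have brI : br I = g i by exact: brE.
have gD c d : g (c + d)%N = g c + q ^+ c * g d.
  by rewrite /g qintD natrD natrM natrX.
have gS c : g c.+1 = g c + q ^+ c by rewrite /g qintS natrD natrX.
have qX c : q ^+ c = 1 + (q - 1) * g c.
  elim: c => [|c IHc]; first by rewrite /g qint0 mulr0 addr0.
  by rewrite gS exprS IHc; ring.
have qM2 : q ^+ (2 * i + 1) = q ^+ i * q ^+ i * q.
  by rewrite exprD expr1 mulnC exprM expr2.
(* Rewriting with gE turns every entry into a polynomial in q, g i, g j
   and g m. *)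
have gE := (nE, kE, gD, gS, exprD, exprS, qX).
have brs := (brN, brK, brKI, brNK, brNKI, brK1, brKI1, brKI2, brKpI, brI).
(* Opaque i, q, g and br keep ring from comparing its atoms by computation. *)
clearbody i q g br.
have ip_self (z : subsp V k) : ip (hatu hat (val z)) (hatu hat (val z))
    = q ^+ k * br K * br (N - K).
  by rewrite ipE capvv (dim_subsp z) !brs !gE; ring.
have ip_meet (z : subsp V k) : (W <= val z)%VS ->
    ip (hatu hat (val z)) (hatu hat W) = q ^+ k * br (K - I) * br (N - K).
  move=> Wz; rewrite ipE (dim_subsp z) (capv_idPr Wz) dW.
  by rewrite !brs !gE; ring.
have ip_join (z : subsp V k) : (val z <= val x + val y)%VS ->
    ip (hatu hat (val z)) (hatu hat (val x + val y)%VS)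
    = q ^+ (k + i) * br K * br (N - K - I).
  move=> zS; rewrite ipE (capv_idPl zS) (dim_subsp z) dS.
  by rewrite !brs !gE; ring.
have ip_xy : ip (hatu hat (val x)) (hatu hat (val y))
    = br N * br (K - I) - br K ^+ 2.
  by rewrite ipE !dim_subsp -/W dW !brs expr2.
have ip_yx : ip (hatu hat (val y)) (hatu hat (val x))
    = br N * br (K - I) - br K ^+ 2.
  by rewrite ipE !dim_subsp capvC -/W dW !brs expr2.
have ip_Bx : ip (vecB hat x y) (hatu hat (val x))
    = b * (br N * br (K - 1) - br K ^+ 2).
  rewrite (ipB _ (i + j)%N) => [|z]; last first.
    by rewrite capvC inE !dim_subsp => /and3P[_ /eqP dz _]; lia.
  by rewrite dim_subsp /b qM2 exprS !brs; ring.
have ip_By : ip (vecB hat x y) (hatu hat (val y))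
    = b * (br N * br (K - I - 1) - br K ^+ 2).
  rewrite (ipB _ j) => [|z]; last first.
    by rewrite capvC inE -/W dW => /and3P[_ _ /eqP[]].
  by rewrite dim_subsp /b qM2 exprS !brs; ring.
have ip_BW : ip (vecB hat x y) (hatu hat W)
    = b * (br N * br (K - I - 1) - br (K - I) * br K).
  rewrite (ipB _ j) => [|z zB]; last first.
    have yzx := farther_cap dim_yx zB.
    rewrite capvC /W -capvA (capv_idPr yzx).
    by move: zB; rewrite inE -/W dW => /and3P[_ _ /eqP[]].
  by rewrite dW /b qM2 exprS !brs; ring.
have ip_BS : ip (vecB hat x y) (hatu hat (val x + val y)%VS)
    = b * (br N * br (K - 1) - br K * br (K + I)).
  rewrite (ipB _ (i + j)%N) => [|z zB]; last first.
    rewrite (farther_cap_sum dim_yx zB).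
    by move: zB; rewrite inE !dim_subsp => /and3P[_ /eqP dz _]; lia.
  by rewrite dS /b qM2 exprS !brs; ring.
have ip_Cx : ip (vecC hat x y) (hatu hat (val x))
    = br I ^+ 2 * (br N * br (K - 1) - br K ^+ 2).
  rewrite (ipC _ (i + j)%N) => [|z]; last first.
    by rewrite capvC inE !dim_subsp => /and3P[_ /eqP dz _]; lia.
  by rewrite dim_subsp !brs; ring.
have ip_Cy : ip (vecC hat x y) (hatu hat (val y))
    = br I ^+ 2 * (br N * br (K - I + 1) - br K ^+ 2).
  rewrite (ipC _ j.+2) => [|z]; last first.
    by rewrite capvC inE -/W dW => /and3P[_ _ /eqP].
  by rewrite dim_subsp !brs; ring.
have ip_CW : ip (vecC hat x y) (hatu hat W)
    = q ^+ k * br I ^+ 2 * br (K - I) * br (N - K).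
  rewrite (ipC _ j.+1) => [|z zC]; last first.
    by have [/capv_idPr-> _] := closer_between zC.
  by rewrite dW !brs !gE; ring.
have ip_CS : ip (vecC hat x y) (hatu hat (val x + val y)%VS)
    = q ^+ (k + i) * br I ^+ 2 * br K * br (N - K - I).
  rewrite (ipC _ k) => [|z zC]; last first.
    have [_ /capv_idPl->] := closer_between zC.
    by move: zC; rewrite inE dim_subsp => /and3P[/eqP].
  by rewrite dS !brs !gE; ring.
apply/matrixP => r c; rewrite !mxE.
case: r => [[|[|[|[|//]]]] ?]; case: c => [[|[|[|[|//]]]] ?].
- exact: (ip_self x).
- exact: ip_xy.
- exact: (ip_meet x).
- exact: (ip_join x).
- exact: ip_yx.
- exact: (ip_self y).
- exact: (ip_meet y).
- exact: (ip_join y).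
- exact: ip_Bx.
- exact: ip_By.
- exact: ip_BW.
- exact: ip_BS.
- exact: ip_Cx.
- exact: ip_Cy.
- exact: ip_CW.
- exact: ip_CS.
Qed.
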